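(* Let $1\le p<n$ and $p<\beta<n$, and let $\mathcal S$ be a sparse family in some dyadic grid of $\mathbb R^n$. There is a constant $c(n,p,\beta)$, depending only on $n,p,\beta$, such that for every $g\in \dot M^{p,\,pn/\beta}(\mathbb R^n)$ with $g\ge 0$, $$I^{\mathcal S}_{1,L^p}g(x)\le c(n,p,\beta)\Bigl[\sup_{Q\in\mathcal S,\ x\in Q}\Bigl(\frac1{|Q|}\int_Q g^p\,dy\Bigr)^{1/p}\Bigr]^{1-\frac p\beta}\,\|g\|_{\dot M^{p,\,pn/\beta}(\mathbb R^n)}^{\frac p\beta},\qquad x\in\mathbb R^n,$$ with the convention that the supremum over the empty family equals $0$.
   Context: Cubes have sides parallel to the axes and $\ell(Q)$ is the side length of $Q$. A dyadic grid $\mathcal D$ is a collection of cubes such that: (1) each cube has side length $2^k$ for some $k\in\mathbb Z$; (2) for any $P,Q\in\mathcal D$, $P\cap Q\in\{\emptyset,P,Q\}$; (3) for each $k\in\mathbb Z$ the cubes of $\mathcal D$ of side length $2^k$ form a partition of $\mathbb R^n$. A subcollection $\mathcal S$ of a dyadic grid is sparse if for every $Q\in\mathcal S$ there is a measurable set $E_Q\subseteq Q$ with $|Q|\le 2|E_Q|$ and the sets $\{E_Q\}_{Q\in\mathcal S}$ are pairwise disjoint. For a sparse family $\mathcal S$, $$I^{\mathcal S}_{1,L^p}g=\sum_{Q\in\mathcal S}\ell(Q)\Bigl(\frac1{|Q|}\int_Q|g|^p\Bigr)^{1/p}\mathbf 1_Q.$$ Homogeneous Morrey seminorm: for $1\le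 p\le q<\infty$, $$\|h\|_{\dot M^{p,q}(\mathbb R^n)}=\sup_{x\in\mathbb R^n,\ r>0} r^{\,n(\frac1q-\frac1p)}\Bigl(\int_{B(x,r)}|h(y)|^p\,dy\Bigr)^{1/p},$$ and $h\in\dot M^{p,q}(\mathbb R^n)$ means that $h$ is measurable with $\|h\|_{\dot M^{p,q}(\mathbb R^n)}<\infty$. *)

(* Defs.v *)
From HB Require Import structures.
From mathcomp Require Import all_boot all_order all_algebra.
From mathcomp Require Import all_classical all_reals all_analysis.

Set Implicit Arguments.
Unset Strict Implicit.
Unset Printing Implicit Defensive.
Import Order.TTheory GRing.Theory Num.Theory.

Local Open Scope classical_set_scope.
Local Open Scope ring_scope.

Section lebesgue_measure_cons.
Context {R : realType} {n : nat}.
Variable mu : {sigma_finite_measure set (n.-tuple (measurableTypeR R)) -> \bar R}.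
Local Open Scope ereal_scope.

Definition pair_cons (z : measurableTypeR R * n.-tuple (measurableTypeR R)) :
  n.+1.-tuple (measurableTypeR R) := [the n.+1.-tuple _ of z.1 :: z.2].

Lemma measurable_pair_cons : measurable_fun setT pair_cons.
Proof. exact: measurable_cons. Qed.

Definition lebesgue_cons : set (n.+1.-tuple (measurableTypeR R)) -> \bar R :=
  pushforward (@lebesgue_measure R \x mu) pair_cons.

Let lebesgue_cons0 : lebesgue_cons set0 = 0.
Proof. by rewrite /lebesgue_cons /pushforward preimage_set0; exact: measure0. Qed.

Let lebesgue_cons_ge0 A : 0 <= lebesgue_cons A.
Proof. by rewrite /lebesgue_cons /pushforward; exact: measure_ge0. Qed.

Let lebesgue_cons_sigma_additive : semi_sigma_additive lebesgue_cons.
Proof.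
exact: (@measure_semi_sigma_additive _ _ _
  (measure_function_pushforward__canonical__measure_function_Measure
     (@lebesgue_measure R \x mu) measurable_pair_cons)).
Qed.

HB.instance Definition _ := isMeasure.Build _ _ _ lebesgue_cons
  lebesgue_cons0 lebesgue_cons_ge0 lebesgue_cons_sigma_additive.

Let lebesgue_cons_sigma_finite : sigma_finite setT lebesgue_cons.
Proof.
have /sigma_finiteP[F [TF ndF Foo]] := sigma_finiteT (@lebesgue_measure R).
have /sigma_finiteP[G [TG ndG Goo]] := sigma_finiteT mu.
pose H k := [set x : n.+1.-tuple (measurableTypeR R) |
  F k (thead x) /\ G k [tuple of behead x]].
have pH k : pair_cons @^-1` H k = F k `*` G k.
  have bE (a : measurableTypeR R) (b : n.-tuple (measurableTypeR R)) :
    [tuple of behead (pair_cons (a, b))] = b by exact/val_inj.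
  by apply/seteqP; split=> -[a b] /=; rewrite /H /= bE.
exists H.
  apply/esym; rewrite -subTset => x _.
  have : (\bigcup_k F k) (thead x) by rewrite -TF.
  have : (\bigcup_k G k) [tuple of behead x] by rewrite -TG.
  move=> [i _ Gi] [j _ Fj]; exists (maxn i j) => //; split.
  - by move: Fj; apply/subsetPset/ndF/leq_maxr.
  - by move: Gi; apply/subsetPset/ndG/leq_maxl.
move=> k; have [mF Fk] := Foo k; have [mG Gk] := Goo k; split.
  have -> : H k = ((fun x => tnth x ord0) @^-1` F k) `&`
      ((fun x : n.+1.-tuple (measurableTypeR R) => [tuple of behead x]) @^-1` G k).
    by [].
  apply: measurableI; rewrite -[X in measurable X]setTI.
  - exact: (@measurable_tnth _ (measurableTypeR R) n.+1 ord0).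
  - exact: (@measurable_behead _ (measurableTypeR R) n).
rewrite [ltLHS](_ : _ = (@lebesgue_measure R \x mu) (F k `*` G k)); last first.
  by rewrite -pH.
by rewrite product_measure1E// lte_mul_pinfty// ge0_fin_numE.
Qed.

HB.instance Definition _ := Measure_isSigmaFinite.Build _ _ _ lebesgue_cons
  lebesgue_cons_sigma_finite.

End lebesgue_measure_cons.

(* Product Lebesgue measure on the Borel sets of R^n; R^0 is a point of
   mass 1. *)
Fixpoint borel_lebesgue (R : realType) (n : nat) :
    {sigma_finite_measure set (n.-tuple (measurableTypeR R)) -> \bar R} :=
  match n with
  | 0 => dirac [tuple]
  | m.+1 => lebesgue_cons (borel_lebesgue R m)
  end.

(* R^n with its Lebesgue sigma-algebra, i.e. the Caratheodory-measurable sets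
   of the outer measure induced by the Borel product measure. *)
Definition Rn (R : realType) (n : nat) : measurableType _ :=
  caratheodory_type ((borel_lebesgue R n)^*)%mu.

Definition leb (R : realType) (n : nat) : {measure set (Rn R n) -> \bar R} :=
  @completed_measure_extension _ _ _ (borel_lebesgue R n).

Section defs.
Context {R : realType} {n : nat}.
Implicit Types (D S : set (set (Rn R n))) (Q : set (Rn R n)) (p q : R).

Definition coord (x : Rn R n) (i : 'I_n) : R :=
  tnth (x : n.-tuple (measurableTypeR R)) i.

Definition euclidean_ball (x : Rn R n) (r : R) : set (Rn R n) :=
  [set y | Num.sqrt (\sum_(i < n) (coord y i - coord x i) ^+ 2) < r].

(* Each face of the cube, [lo i] for the lower one and [hi i] for the upper
   one, may or may not belong to it: [BLeft] as a left bound and [BRight] as a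
   right bound mean that the endpoint is included. *)
Definition is_cube (l : R) Q := 0 < l /\
  exists (a : 'I_n -> R) (lo hi : 'I_n -> bool), Q =
    [set x | forall i, coord x i \in
      Interval (BSide (lo i) (a i)) (BSide (hi i) (a i + l))].

Definition side Q : R := xget 0 [set l | is_cube l Q].

Definition dyadic_grid D :=
  [/\ forall Q, D Q -> exists k : int, is_cube ((2 : R) ^ k) Q,
      forall P Q, D P -> D Q ->
        [\/ P `&` Q = set0, P `&` Q = P | P `&` Q = Q] &
      forall k : int,
        partition [set Q | D Q /\ is_cube ((2 : R) ^ k) Q] id setT].

Definition sparse S := exists E : set (Rn R n) -> set (Rn R n),
  (forall Q, S Q ->
    [/\ measurable (E Q), E Q `<=` Q & (leb R n Q <= 2%:E * leb R n (E Q))%E])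
  /\ trivIset S E.

Local Open Scope ereal_scope.

(* Meaningful for h >= 0 only: no absolute value is taken inside the power. *)
Definition pmean p (h : Rn R n -> R) Q : \bar R :=
  ((fine (leb R n Q))^-1%:E * \int[leb R n]_(y in Q) (h y `^ p)%:E) `^ p^-1.

Definition sparse_op S p (g : Rn R n -> R) (x : Rn R n) : \bar R :=
  \esum_(Q in S) ((side Q)%:E * pmean p (fun y => `|g y|%R) Q * (\1_Q x)%:E).

Definition morrey_norm p q (h : Rn R n -> R) : \bar R :=
  ereal_sup [set z | exists (x : Rn R n) (r : R), (0 < r)%R /\
    z = (r `^ (n%:R * (q^-1 - p^-1)))%:E *
        (\int[leb R n]_(y in euclidean_ball x r) (`|h y| `^ p)%:E) `^ p^-1].

Definition morrey p q (h : Rn R n -> R) :=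
  measurable_fun setT h /\ morrey_norm p q h < +oo.

End defs.

(* Supremum in [0, +oo]: the supremum of the empty set is 0, while
   [ereal_sup set0] is -oo. *)
Definition nneg_esup {R : realType} (A : set (\bar R)) : \bar R :=
  if A == set0 then 0%E else ereal_sup A.

Lemma borel_lebesgue_box (R : realType) n (A : 'I_n -> set (measurableTypeR R)) :
  (forall i, measurable (A i)) ->
  measurable [set x : n.-tuple (measurableTypeR R) | forall i, A i (tnth x i)] /\
  borel_lebesgue R n [set x | forall i, A i (tnth x i)] =
    (\prod_(i < n) lebesgue_measure (A i))%E.
Proof.
move=> mA; split.
  rewrite (_ : [set x | _] =
      \bigcap_(i in [set: 'I_n]) ((fun x => tnth x i) @^-1` A i)).
    apply: fin_bigcap_measurable => // i _.
    rewrite -[X in measurable X]setTI.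
    exact: (@measurable_tnth _ (measurableTypeR R) n i).
  by apply/seteqP; split=> x /= h i; [move=> _|]; exact: h.
elim: n A mA => [|n ih] A mA.
  rewrite big_ord0 /= /dirac indicE mem_set//.
  by case.
rewrite big_ord_recl /= /lebesgue_cons /pushforward.
have mB : measurable [set x : n.-tuple (measurableTypeR R) | forall i, A (lift ord0 i) (tnth x i)].
  rewrite (_ : [set x | _] =
      \bigcap_(i in [set: 'I_n]) ((fun x => tnth x i) @^-1` A (lift ord0 i))).
    apply: fin_bigcap_measurable => // i _.
    rewrite -[X in measurable X]setTI.
    exact: (@measurable_tnth _ (measurableTypeR R) n i).
  by apply/seteqP; split=> x /= h i; [move=> _|]; exact: h.
rewrite (_ : _ @^-1` _ = A ord0 `*`
    [set x : n.-tuple (measurableTypeR R) | forall i, A (lift ord0 i) (tnth x i)]).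
  rewrite product_measure1E//.
  congr (_ * _)%E; exact: ih.
apply/seteqP; split=> -[a b] /=; rewrite /pair_cons /=.
  move=> h; split; first exact: (h ord0).
  by move=> i; have := h (lift ord0 i); rewrite tnthS.
move=> [h1 h2] i; case: (unliftP ord0 i) => [j|] ->; first by rewrite tnthS.
exact: h1.
Qed.

Lemma leb_cube (R : realType) n l (Q : set (Rn R n)) :
  is_cube l Q -> measurable Q /\ leb R n Q = (l ^+ n)%:E.
Proof.
move=> [l0 [a [lo [hi QE]]]].
pose A i : set (measurableTypeR R) :=
  [set` Interval (BSide (lo i) (a i)) (BSide (hi i) (a i + l))].
have mA i : measurable (A i) by exact: measurable_itv.
have [mB E] := @borel_lebesgue_box R n A mA.
have -> : Q =
    [set x : n.-tuple (measurableTypeR R) | forall i, A i (tnth x i)] by [].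
split; first exact: caratheodory_measurable_mu_ext.
transitivity (borel_lebesgue R n [set x | forall i, A i (tnth x i)]).
  exact: (@measurable_mu_extE _ _ _ (borel_lebesgue R n)).
rewrite E (eq_bigr (fun=> l%:E)); last first.
  move=> i _; rewrite /A lebesgue_measure_itv/= lte_fin ltrDl l0.
  by rewrite -EFinB addrC addKr.
by rewrite prodEFin prodr_const card_ord.
Qed.

Lemma side_cube (R : realType) n l (Q : set (Rn R n)) :
  (0 < n)%N -> is_cube l Q -> side Q = l.
Proof.
move=> n0 Ql; rewrite /side; case: xgetP => [l' _ Ql'|/(_ l)//].
have [_ e] := leb_cube Ql; have [_ e'] := leb_cube Ql'.
move: e; rewrite e' => -[] /eqP; rewrite eqrXn2 ?ltW//; last 2 first.
- by case: Ql'.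
- by case: Ql.
by move/eqP.
Qed.

(* Main.v *)
Require Import Defs.
From mathcomp Require Import all_boot all_order all_algebra.
From mathcomp Require Import all_classical all_reals all_analysis.
From mathcomp Require Import measurable_realfun.
From mathcomp Require Import zify ring lra.
Import Order.TTheory GRing.Theory Num.Theory.
Local Open Scope classical_set_scope.
Local Open Scope ring_scope.

(** This is Hedberg's splitting argument, run over the dyadic scales above a
    single point.

    Fix [x]. The cubes of the grid that contain [x] have pairwise distinct side
    lengths [2 ^ k], because the cubes of one scale are disjoint
    ([dyadic_cube_unique]); so the operator at [x] is a sum over distinct
    integers [k] of [2 ^ k] times the [L^p] mean of [g] over the cube of that
    scale. Each mean has two upper bounds: the supremum [M], which is the good
    one on small cubes, and, comparing the cube with a ball of comparable
    radius around [x], the Morrey bound [C * N * (2 ^ k) `^ (- theta)] with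
    [theta = beta / p] and [N] the Morrey norm ([pmean_le_morrey]), which is the
    good one on large cubes.

    As [theta > 1], the series of [2 ^ k * min M (C N (2 ^ k) `^ (- theta))] is
    geometrically decreasing on both sides of the scale where the two bounds
    agree, [2 ^ k = (C N / M) `^ theta^-1]. Its sum is therefore a constant
    times the value [M `^ (1 - theta^-1) * (C N) `^ theta^-1] at that scale
    ([sum_dyadic_min_le]), which is the claim. *)

(** * Two-sided geometric sums *)

Lemma sum_geometric_uniq (R : realFieldType) (a : R) (s : seq nat) :
  0 <= a < 1 -> uniq s -> \sum_(j <- s) a ^+ j <= (1 - a)^-1.
Proof.
move=> /andP[a0 a1] us; pose N := (\max_(j <- s) j).+1.
have sN j : j \in s -> (j < N)%N by move=> js; rewrite ltnS leq_bigmax_seq.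
have ps : perm_eq s [seq j <- iota 0 N | j \in s].
  apply: uniq_perm => //; first by rewrite filter_uniq// iota_uniq.
  move=> j; rewrite mem_filter mem_iota add0n/=.
  by case: (boolP (j \in s)) => // /sN ->.
rewrite (perm_big _ ps) big_filter big_mkcond.
apply: (@le_trans _ _ (\sum_(0 <= j < N) a ^+ j)).
  by rewrite /index_iota subn0; apply: ler_sum => j _; case: ifP => // _;
    exact: exprn_ge0.
rewrite big_mkord -[leLHS]mul1r -[X in X * _](@mulVf _ (1 - a)); last by lra.
have e := subrX1 a N.
rewrite -mulrA (_ : (1 - a) * _ = 1 - a ^+ N); last first.
  by rewrite -opprB mulNr -e opprB.
rewrite ler_piMr// ?invr_ge0; first by lra.
by rewrite gerBl exprn_ge0.
Qed.

(** The two bounds on [v i] cross at the scale [lam = (B / M) `^ theta^-1], where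
    both give [2 ^ k * v = M * lam], which is the interpolated right-hand side.
    Below [lam] the terms decay with ratio [1 / 2], above it with ratio
    [2 `^ (1 - theta)]; distinctness of the exponents [k i] makes each half a
    subsum of a geometric series. *)
Lemma sum_dyadic_min_le (R : realType) (I : eqType) (s : seq I) (k : I -> int)
    (v : I -> R) (M B theta : R) :
  1 < theta -> 0 < M -> 0 < B -> uniq [seq k i | i <- s] ->
  (forall i, i \in s -> v i <= M /\ v i <= B * (2 ^ k i) `^ (- theta)) ->
  \sum_(i <- s) 2 ^ k i * v i <=
    (2 + (1 - 2 `^ (1 - theta))^-1) * (M `^ (1 - theta^-1) * B `^ theta^-1).
Proof.
move=> theta1 M0 B0 uks vle.
have theta0 : 0 < theta by lra.
have half01 : 0 <= (2^-1 : R) < 1 by lra.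
have half_series : (1 - 2^-1)^-1 = 2 :> R by field.
have dist_inj_le (c x y : int) :
    x <= c -> y <= c -> `|c - x|%N = `|c - y|%N -> x = y by lia.
have dist_inj_gt (c x y : int) :
    c < x -> c < y -> `|x - (c + 1)%R|%N = `|y - (c + 1)%R|%N -> x = y by lia.
have thetaN0 : theta != 0 by rewrite gt_eqF.
have pow2_gt0 j : 0 < 2 ^ j :> R by rewrite exprz_gt0.
pose a : R := 2 `^ (1 - theta).
have a01 : 0 <= a < 1.
  rewrite powR_ge0/= /a /powR gt_eqF// -[ltRHS]expR0 ltr_expR.
  by rewrite nmulr_rlt0 ?subr_lt0// ln_gt0// ltr1n.
have uksf P : uniq [seq k i | i <- s & P i].
  apply: subseq_uniq uks; exact/map_subseq/filter_subseq.
pose lam := (B / M) `^ theta^-1.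
have lam0 : 0 < lam by rewrite powR_gt0// divr_gt0.
have lamB : M * lam `^ theta = B.
  by rewrite /lam -powRrM mulVf// powRr1 ?divr_ge0 ?ltW// mulrC divfK// gt_eqF.
have -> : M `^ (1 - theta^-1) * B `^ theta^-1 = M * lam.
  rewrite /lam powRM ?invr_ge0 ?ltW// -(powR_inv1 (ltW M0)) -powRrM mulN1r powRD.
    by rewrite powRr1 ?ltW// mulrA mulrAC.
  by rewrite (gt_eqF M0) implybT.
(* [2 ^ k0] is the largest power of two not exceeding [lam]. *)
pose k0 := Num.floor (ln lam / ln 2).
have ln2 : 0 < ln (2 : R) by rewrite ln_gt0// ltr1n.
have lamE : lam = 2 `^ (ln lam / ln 2).
  by rewrite /powR gt_eqF// divfK ?gt_eqF// lnK.
have k0_le : 2 ^ k0 <= lam.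
  rewrite lamE -powR_intmul// ler_powR ?ler1n//; exact: floor_le.
have le_k0 : lam <= 2 ^ (k0 + 1).
  rewrite lamE -powR_intmul// ler_powR ?ler1n//.
  by case/andP: (floor_itv (ln lam / ln 2)) => _ /ltW.
rewrite (bigID (fun i => k i <= k0))/= [leRHS]mulrC mulrDr lerD//.
(* Scales up to [lam], where [v i <= M] is used. *)
- apply: (@le_trans _ _ (M * lam * \sum_(j <- [seq `|k0 - k i|%N |
      i <- s & k i <= k0]) 2^-1 ^+ j)).
    rewrite big_map big_filter mulr_sumr big_seq_cond [leRHS]big_seq_cond.
    apply: ler_sum => i /andP[si ki].
    have kE : k i = k0 + - (`|k0 - k i|%N%:Z).
      by rewrite abszE ger0_norm ?subr_ge0// subKr.
    have -> : 2 ^ k i = 2 ^ k0 * 2^-1 ^+ `|k0 - k i|%N :> R.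
      by rewrite [in LHS]kE expfzDr ?pnatr_eq0// exprVn -invr_expz.
    rewrite mulrAC; apply: ler_wpM2r; first by rewrite exprn_ge0// invr_ge0.
    rewrite [leRHS]mulrC.
    have [vM _] := vle _ si.
    apply: le_trans (ler_wpM2r (ltW M0) k0_le).
    by rewrite ler_pM2l.
  apply: ler_wpM2l; first by rewrite mulr_ge0 ?ltW.
  rewrite -[leRHS]half_series; apply: sum_geometric_uniq => //.
  rewrite (map_comp (fun j => `|k0 - j|%N) k) map_inj_in_uniq//.
  move=> x y /mapP[i + ->] /mapP[j + ->].
  by rewrite !mem_filter => /andP[ki _] /andP[kj _]; exact: dist_inj_le.
(* Scales above [lam], where the decaying bound is used. Distances are counted
   from [k0 + 1], where [lam <= 2 ^ (k0 + 1)]: the exponent [1 - theta] is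
   negative, so this inequality is the one that bounds
   [(2 ^ (k0 + 1)) `^ (1 - theta)] from above by [lam `^ (1 - theta)]. *)
- apply: (@le_trans _ _ (M * lam * \sum_(j <- [seq `|k i - (k0 + 1)%R|%N |
      i <- s & ~~ (k i <= k0)]) a ^+ j)).
    rewrite big_map big_filter mulr_sumr big_seq_cond [leRHS]big_seq_cond.
    apply: ler_sum => i /andP[si]; rewrite -ltNge => ki.
    set j := `|_|%N.
    have kE : k i = (k0 + 1) + j%:Z.
      by rewrite /j abszE ger0_norm ?subr_ge0 ?lezD1// subrKC.
    have [_ vB] := vle _ si.
    apply: le_trans (ler_wpM2l (ltW (pow2_gt0 (k i))) vB) _.
    rewrite mulrCA.
    have -> : (2 ^ k i : R) * (2 ^ k i) `^ (- theta) = (2 ^ k i) `^ (1 - theta).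
      by rewrite powRD ?powRr1 ?ltW// (gt_eqF (pow2_gt0 _)) implybT.
    rewrite kE expfzDr ?pnatr_eq0// powRM ?(ltW (pow2_gt0 _))// -exprnP.
    have -> : ((2 : R) ^+ j) `^ (1 - theta) = a ^+ j.
      by rewrite -powR_mulrn// powRAC powR_mulrn// powR_ge0.
    rewrite mulrA.
    apply: ler_wpM2r; first by rewrite exprn_ge0//; case/andP: a01.
    have -> : M * lam = B * lam `^ (1 - theta).
      rewrite -lamB -mulrA -powRD; last by rewrite (gt_eqF lam0) implybT.
      by rewrite addrC subrK powRr1 ?ltW.
    rewrite ler_pM2l//.
    rewrite -(opprB theta 1) !powRN.
    rewrite lef_pV2 ?posrE ?(powR_gt0 _ lam0) ?(powR_gt0 _ (pow2_gt0 _))//.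
    by apply: ge0_ler_powR => //; rewrite ?nnegrE ?subr_ge0; exact: ltW.
  apply: ler_wpM2l; first by rewrite mulr_ge0 ?ltW.
  apply: sum_geometric_uniq => //.
  rewrite (map_comp (fun j => `|j - (k0 + 1)%R|%N) k) map_inj_in_uniq//.
  move=> x y /mapP[i + ->] /mapP[j + ->].
  by rewrite !mem_filter -!ltNge => /andP[ki _] /andP[kj _]; exact: dist_inj_gt.
Qed.

(** * Cubes, balls and the Morrey norm *)

(** The diameter of the cube is at most [Num.sqrt n%:R * l]; the radius uses
    [n.+1] because [sqrt n < n + 1] holds strictly for every [n], as an open ball
    requires. *)
Lemma cube_subset_ball (R : realType) (n : nat) (l : R) (Q : set (Rn R n))
    (x : Rn R n) :
  is_cube l Q -> Q x -> Q `<=` euclidean_ball x (n.+1%:R * l).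
Proof.
move=> [l0 [a [lo [hi ->]]]] /= Qx y /= Qy; rewrite /euclidean_ball/=.
have near i : (Defs.coord y i - Defs.coord x i) ^+ 2 <= l ^+ 2.
  rewrite -real_normK ?num_real// ler_pXn2r// ?nnegrE// ?(ltW l0)// ler_distl.
  move: (Qx i) (Qy i); rewrite !itv_boundlr => /andP[x1 x2] /andP[y1 y2].
  have w (b : bool) (u v : R) :
      (BSide b u <= BLeft v)%O -> u <= v by case: b => //=; exact: ltW.
  have w' (b : bool) (u v : R) :
      (BRight v <= BSide b u)%O -> v <= u by case: b => //=; exact: ltW.
  move: (w _ _ _ x1) (w' _ _ _ x2) (w _ _ _ y1) (w' _ _ _ y2); lra.
have r0 : 0 < n.+1%:R * l by rewrite mulr_gt0.
rewrite -[ltRHS](ger0_norm (ltW r0)) -sqrtr_sqr ltr_sqrt ?exprn_gt0//.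
apply: (@le_lt_trans _ _ (\sum_(i < n) l ^+ 2)); first exact: ler_sum.
rewrite sumr_const card_ord -[ltLHS]mulr_natl exprMn ltr_pM2r ?exprn_gt0//.
by rewrite -natrX ltr_nat; nia.
Qed.

Lemma measurable_euclidean_ball (R : realType) (n : nat) (x : Rn R n) (r : R) :
  0 < r -> measurable (euclidean_ball x r).
Proof.
move=> r0; apply: caratheodory_measurable_mu_ext.
rewrite (_ : euclidean_ball x r =
    (fun y : n.-tuple (measurableTypeR R) =>
      \sum_(i < n) (tnth y i - Defs.coord x i) ^+ 2) @^-1` `]-oo, r ^+ 2[).
  rewrite -[X in measurable X]setTI.
  suff : measurable_fun setT (fun y : n.-tuple (measurableTypeR R) =>
    \sum_(i < n) (tnth y i - Defs.coord x i) ^+ 2).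
    by apply=> //; exact: measurable_itv.
  apply: measurable_sum => i; apply: measurable_funX.
  by apply: measurable_funB => //; exact: measurable_tnth.
have sqrtE s : (Num.sqrt s < r) = (s < r ^+ 2).
  by rewrite -{1}(ger0_norm (ltW r0)) -sqrtr_sqr ltr_sqrt ?exprn_gt0.
by apply/seteqP; split=> y; rewrite /euclidean_ball/= in_itv/= sqrtE.
Qed.

Lemma dyadic_cube_unique (R : realType) (n : nat) (D : set (set (Rn R n)))
    (k : int) (P Q : set (Rn R n)) (x : Rn R n) :
  dyadic_grid D -> D P -> D Q -> is_cube ((2 : R) ^ k) P ->
  is_cube ((2 : R) ^ k) Q -> P x -> Q x -> P = Q.
Proof.
move=> [_ _ /(_ k)[_ + _]] DP DQ cP cQ Px Qx.
by apply; [split|split|exists x].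
Qed.

(** Scaling: the mean carries the factor [l `^ (- n / p)], while the Morrey norm
    bounds the [L^p] norm over a ball of radius [r] by
    [r `^ (n * (p^-1 - q^-1))] times itself. With [r] equal to [n.+1] times [l],
    the powers of [l] combine to [l `^ (- n / q)]. *)
Lemma pmean_le_morrey (R : realType) (n : nat) (p q l : R) (g : Rn R n -> R)
    (Q : set (Rn R n)) :
  0 < p -> measurable_fun setT g -> (forall y, 0 <= g y) ->
  is_cube l Q -> Q !=set0 ->
  (pmean p g Q <= (n.+1%:R `^ (n%:R * (p^-1 - q^-1)) *
    l `^ (- (n%:R / q)))%:E * morrey_norm p q g)%E.
Proof.
move=> p0 mg g0 cQ [x Qx]; have [mQ lebQ] := leb_cube cQ.
have l0 : 0 < l by case: cQ.
pose r := n.+1%:R * l; have r0 : 0 < r by rewrite mulr_gt0.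
pose J := (\int[leb R n]_(y in euclidean_ball x r) (g y `^ p)%:E)%E.
have J0 : (0 <= J)%E by apply: integral_ge0 => y _; rewrite lee_fin powR_ge0.
have intQ : (\int[leb R n]_(y in Q) (g y `^ p)%:E <= J)%E.
  apply: ge0_subset_integral => //.
  - exact: measurable_euclidean_ball.
  - apply/measurable_EFinP; apply: (measurableT_comp (measurable_powR p)).
    exact: measurable_funTS.
  - by move=> y _; rewrite lee_fin powR_ge0.
  - exact: cube_subset_ball.
have normJ : ((r `^ (n%:R * (q^-1 - p^-1)))%:E * J `^ p^-1 <=
    morrey_norm p q g)%E.
  apply: ereal_sup_ubound; exists x, r; split => //.
  congr (_ * _ `^ _)%E; apply: eq_integral => y _.
  by rewrite ger0_norm.
apply: (@le_trans _ _ ((l `^ (- (n%:R / p)))%:E * J `^ p^-1)%E).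
  rewrite /pmean lebQ/= poweRM ?lee_fin ?invr_ge0 ?exprn_ge0 ?(ltW l0)//; last first.
    by apply: integral_ge0 => y _; rewrite lee_fin powR_ge0.
  rewrite poweR_EFin (_ : (l ^- n) `^ p^-1 = l `^ (- (n%:R / p))); last first.
    by rewrite powRN powRrM powR_mulrn ?(ltW l0)// -powR_inv1 ?powR_ge0 ?exprn_ge0
      ?(ltW l0)// powRAC powR_inv1// powR_ge0.
  apply: lee_wpmul2l; first by rewrite lee_fin powR_ge0.
  apply: gt0_ler_poweR => //; rewrite ?invr_ge0 ?ltW// in_itv/= leey andbT//.
  by apply: integral_ge0 => y _; rewrite lee_fin powR_ge0.
have -> : l `^ (- (n%:R / p)) = n.+1%:R `^ (n%:R * (p^-1 - q^-1)) *
    l `^ (- (n%:R / q)) * r `^ (n%:R * (q^-1 - p^-1)).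
  rewrite /r (powRM _ (ler0n _ _) (ltW l0)) mulrACA -!powRD; last 2 first.
  - by rewrite (gt_eqF l0) implybT.
  - by rewrite pnatr_eq0 implybT.
  rewrite [X in _ `^ X * _](_ : _ = 0) ?powRr0 ?mul1r; last by ring.
  by congr (_ `^ _); ring.
rewrite EFinM -muleA; apply: lee_wpmul2l normJ.
by rewrite lee_fin mulr_ge0 ?powR_ge0.
Qed.

(** * The pointwise bound *)

Theorem proposition3p4 (R : realType) (n : nat) (p beta : R)
    (p_ge1 : 1 <= p) (p_lt_n : p < n%:R)
    (p_lt_beta : p < beta) (beta_lt_n : beta < n%:R) :
  exists c : R,
    forall D S : set (set (Rn R n)),
      dyadic_grid D -> S `<=` D -> sparse S ->
    forall g : Rn R n -> R,
      morrey p (p * n%:R / beta) g -> (forall y, 0 <= g y) ->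
    forall x : Rn R n,
      (sparse_op S p g x <=
        c%:E * nneg_esup [set pmean p g Q | Q in [set Q | S Q /\ Q x]]
                 `^ (1 - p / beta)
             * morrey_norm p (p * n%:R / beta) g `^ (p / beta))%E.
Proof.
have p0 : 0 < p by lra.
have beta0 : 0 < beta by lra.
have nR0 : 0 < n%:R :> R by lra.
have n0 : (0 < n)%N by rewrite -(ltr0n R).
pose q := p * n%:R / beta; pose theta := beta / p.
have theta1 : 1 < theta by rewrite ltr_pdivlMr// mul1r.
have thetaE : n%:R / q = theta by rewrite /q /theta; field; rewrite !gt_eqF.
have thetaV : p / beta = theta^-1 by rewrite /theta invf_div.
have s0 : 0 < theta^-1 by rewrite invr_gt0; lra.
have s1 : 0 < 1 - theta^-1 by rewrite subr_gt0 invf_lt1//; lra.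
pose C : R := n.+1%:R `^ (n%:R * (p^-1 - q^-1)).
pose K : R := 2 + (1 - 2 `^ (1 - theta))^-1.
have C0 : 0 < C by rewrite powR_gt0.
have K0 : 0 < K.
  rewrite /K ltr_pwDl// invr_ge0 subr_ge0 -[leRHS](powRr0 (2 : R)).
  by rewrite ler_powR ?ler1n// subr_le0 ltW.
rewrite thetaV -/q; exists (K * C `^ theta^-1).
move=> D S gD SD _ g [mg Nfin] g0 x.
set N := morrey_norm p q g in Nfin *.
set T := [set _ | _ in _].
have pm0 Q : (0 <= pmean p g Q)%E by exact: poweR_ge0.
have N0 : (0 <= N)%E.
  apply: le_ereal_sup_tmp; eexists; first by exists x, 1; split.
  by rewrite mule_ge0 ?poweR_ge0// lee_fin powR_ge0.
have pm_sup Q : S Q -> Q x -> (pmean p g Q <= nneg_esup T)%E.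
  move=> SQ Qx; have TQ : T (pmean p g Q) by exists Q.
  rewrite /nneg_esup; case: eqP => [T0|_]; first by rewrite T0 in TQ.
  exact: ereal_sup_ubound.
have sup0 : (0 <= nneg_esup T)%E.
  rewrite /nneg_esup; case: eqP => // /eqP/set0P[_ [Q SQ _]].
  by apply: le_ereal_sup_tmp; exists (pmean p g Q) => //; exists Q.
set M := nneg_esup T in pm_sup sup0 *.
have exk Q : exists j : int, S Q -> is_cube ((2 : R) ^ j) Q.
  have [SQ|nSQ] := pselect (S Q); last by exists 0.
  by have [+ _ _] := gD => /(_ Q (SD _ SQ))[j jP]; exists j.
have [k kP] := choice exk.
have pm_morrey Q : S Q -> Q x ->
    (pmean p g Q <= (C * (2 ^ k Q) `^ (- theta))%:E * N)%E.
  move=> SQ Qx; rewrite -thetaE; apply: pmean_le_morrey => //; first exact: kP.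
  by exists x.
have termE Q : S Q ->
    ((side Q)%:E * pmean p (fun y => `|g y|%R) Q * (\1_Q x)%:E)%E =
    (if x \in Q then (2 ^ k Q)%:E * pmean p g Q else 0)%E.
  move=> SQ; rewrite (side_cube n0 (kP _ SQ)) indicE.
  rewrite (_ : (fun y => `|g y|) = g); last first.
    by apply/funext => y; rewrite ger0_norm.
  by case: ifPn => _; rewrite ?mule1 ?mule0.
(* The interpolation needs [M] and [N] nonzero; if one of them is zero, then so
   are all the means. *)
have vanish : (forall Q, S Q -> Q x -> pmean p g Q = 0%E) ->
    (sparse_op S p g x <=
      (K * C `^ theta^-1)%:E * M `^ (1 - theta^-1) * N `^ theta^-1)%E.
  move=> z; rewrite /sparse_op esum1; last first.
    move=> Q SQ; rewrite termE//.
    by case: ifPn => // /set_mem/(z _ SQ) ->; rewrite mule0.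
  by rewrite !mule_ge0 ?poweR_ge0// lee_fin mulr_ge0 ?powR_ge0 ?(ltW K0).
have [M0|Mneq0] := eqVneq M 0%E.
  by apply: vanish => Q SQ Qx; apply/le_anti; rewrite pm0 -M0 pm_sup.
have [Nz|Nneq0] := eqVneq N 0%E.
  apply: vanish => Q SQ Qx; apply/le_anti; rewrite pm0 andbT.
  by rewrite (le_trans (pm_morrey _ SQ Qx))// Nz mule0.
have KC0 : 0 < K * C `^ theta^-1 by rewrite mulr_gt0 ?powR_gt0.
move: (Nfin) (N0) (Nneq0); case NE : N => [B| |]// _ B0 Bneq0.
(* If [M] is infinite, so is the right-hand side, as [N] is positive. *)
move: (sup0) (Mneq0); case ME : M => [m| |]// m0 mneq0; last first.
  have B_gt0 : 0 < B by rewrite lt_neqAle eq_sym -eqe Bneq0 -lee_fin.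
  rewrite poweRyr ?gt_eqF// gt0_muley ?lte_fin//.
  by rewrite gt0_mulye ?leey// lte_fin powR_gt0.
have {m0 mneq0}m0 : 0 < m by rewrite lt_neqAle eq_sym -eqe mneq0 -lee_fin.
have {B0 Bneq0}B0 : 0 < B by rewrite lt_neqAle eq_sym -eqe Bneq0 -lee_fin.
(* From here on everything is finite, and each finite partial sum of the
   operator is a sum of reals over the cubes that contain [x]. *)
pose v Q := fine (pmean p g Q).
have pmE Q : S Q -> Q x -> pmean p g Q = (v Q)%:E.
  move=> SQ Qx; rewrite fineK// ge0_fin_numE//.
  by rewrite (le_lt_trans (pm_sup _ SQ Qx))// ME ltry.
apply: ge_ereal_sup => _ [A [finA AS] <-].
rewrite fsbig_finite//; set s := finmap.enum_fset _.
have sS Q : Q \in s -> S Q by rewrite /s in_fset_set// inE; exact: AS.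
rewrite big_seq_cond.
under eq_bigr => Q /andP[/sS SQ _] do rewrite termE//.
rewrite -big_seq_cond -big_mkcond -big_filter; set t := seq.filter _ _.
have tP Q : Q \in t -> S Q /\ Q x.
  by rewrite mem_filter => /andP[/set_mem Qx /sS SQ].
rewrite big_seq_cond.
under eq_bigr => Q /andP[/tP[SQ Qx] _] do rewrite pmE// -EFinM.
rewrite -big_seq_cond sumEFin !poweR_EFin -!EFinM lee_fin.
have -> : K * C `^ theta^-1 * m `^ (1 - theta^-1) * B `^ theta^-1 =
    K * (m `^ (1 - theta^-1) * (C * B) `^ theta^-1).
  by rewrite (powRM _ (ltW C0) (ltW B0)); ring.
apply: sum_dyadic_min_le => //; first by rewrite mulr_gt0.
- rewrite map_inj_in_uniq ?filter_uniq ?finmap.fset_uniq//.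
  move=> P Q /tP[SP Px] /tP[SQ Qx] kPQ.
  apply: (dyadic_cube_unique _ _ D (k P) P Q x) => //.
  + exact: SD.
  + exact: SD.
  + exact: kP.
  + by rewrite kPQ; exact: kP.
- move=> Q /tP[SQ Qx]; split; rewrite -lee_fin -pmE//.
    by rewrite -ME pm_sup.
  by rewrite mulrAC EFinM -NE pm_morrey.
Qed.
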